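(* Let $G$ be a graph on $[n]$ such that $\mathcal E_G$ is finite-dimensional, and let $d_0$ be the largest $d$ with $\mathcal E_G^d\neq 0$. Then: (a) $\mathcal E_G^{d_0}$ is one-dimensional, spanned by a monomial $w_0^G$ (a product of generators $x_{ij}$ with $\{i,j\}\in G$); (b) for every $Q\in\mathcal E_G$ there exists $p^\vee\in\mathcal E_n^\vee$ with $Q=p^\vee * w_0^G$; (c) for every nonzero $Q\in\mathcal E_G$ there is a monomial $P\in\mathcal E_G$ with $PQ=w_0^G$ (up to a nonzero scalar, i.e. $PQ$ is a nonzero multiple of $w_0^G$); (d) the Hilbert series is palindromic: $\dim\mathcal E_G^d=\dim\mathcal E_G^{d_0-d}$ for all $0\le d\le d_0$; (e) for any expression of $w_0^G$ as a product of generators $p_1\cdots p_{d_0}$, the subwords $p_{i_1}\cdots p_{i_k}$ ($i_1<\dots<i_k$) span $\mathcal E_G$; (f) $\operatorname{rev}(w_0^G)=\pm w_0^G$.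
   Context: Let $n\ge 1$. The Fomin–Kirillov algebra $\mathcal E_n$ is the associative $\mathbb Q$-algebra with generators $x_{ij}$ for ordered pairs of distinct $i,j\in[n]$, subject to $x_{ij}=-x_{ji}$, $x_{ij}^2=0$, $x_{ij}x_{kl}=x_{kl}x_{ij}$ for distinct $i,j,k,l$, and $x_{ij}x_{jk}+x_{jk}x_{ki}+x_{ki}x_{ij}=0$ for distinct $i,j,k$. It is graded by degree (each $x_{ij}$ of degree 1); $\mathcal E_n^d$ is the degree-$d$ part. For a simple graph $G$ on vertex set $[n]$, $\mathcal E_G$ is the subalgebra of $\mathcal E_n$ generated by the $x_{ij}$ with $\{i,j\}$ an edge of $G$; $\mathcal E_G^d$ is its degree-$d$ part and $\mathcal E_G^+=\bigoplus_{d\ge1}\mathcal E_G^d$. $\mathcal E_n$ is also graded by $S_n$: the $S_n$-degree of $x_{ij}$ is the transposition $(i\,j)$, extended multiplicatively to monomials; $\sigma_P$ denotes the $S_n$-degree of an $S_n$-homogeneous $P$. $S_n$ acts by algebra automorphisms via $\sigma(x_{ij})=x_{\sigma(i)\sigma(j)}$. Equip $\mathcal E_n\otimes\mathcal E_n$ with the braided product $(P_1\otimes Q_1)(P_2\otimes Q_2)=P_1\sigma_{Q_1}(P_2)\otimes Q_1Q_2$ for $S_n$-homogeneous $Q_1$. The coproduct $\Delta:\mathcal E_n\to\mathcal E_n\otimes\mathcal E_n$ is the (well-defined) map multiplicative for this product with $\Delta(x_{ij})=x_{ij}\otimes1+1\otimes x_{ij}$. Let $\mathcal E_n^\vee=\bigoplus_d(\mathcal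 E_n^d)^*$ be the graded dual; for $p^\vee\in\mathcal E_n^\vee$ and $Q\in\mathcal E_n$ with $\Delta(Q)=\sum_k Q^k_{(1)}\otimes Q^k_{(2)}$, set $p^\vee*Q=\sum_k p^\vee(Q^k_{(1)})\,Q^k_{(2)}$. The map $\operatorname{rev}$ is the linear antiautomorphism of $\mathcal E_n$ reversing the order of the factors in every monomial. *)

(* Defs.v *)
(* Concrete model of the Fomin--Kirillov algebra E_n:
   elements are represented by formal (non-commutative) polynomials with
   rational coefficients in the generators x_ij (i <> j), i.e. finite lists
   of (coefficient, fkword) pairs; two representatives are equal in E_n iff
   their difference lies in the two-sided ideal generated by the defining
   relations (compared coefficientwise on words). *)
From HB Require Import structures.
From mathcomp Require Import all_boot all_order all_algebra all_fingroup.
Set Implicit Arguments. Unset Strict Implicit. Unset Printing Implicit Defensive.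
Import Order.TTheory GRing.Theory Num.Theory.
Local Open Scope ring_scope.

Section FK.
Variable n : nat.

Definition fkgen := {p : 'I_n * 'I_n | p.1 != p.2}.
Definition fkword := seq fkgen.
Definition fpoly := seq (rat * fkword).

Definition fcoef (f : fpoly) (w : fkword) : rat := \sum_(t <- f | t.2 == w) t.1.
Definition fzero : fpoly := [::].
Definition fadd (f g : fpoly) : fpoly := f ++ g.
Definition fscale (c : rat) (f : fpoly) : fpoly := [seq (c * t.1, t.2) | t <- f].
Definition fsub (f g : fpoly) : fpoly := fadd f (fscale (-1) g).
Definition fmul (f g : fpoly) : fpoly :=
  [seq (t.1 * s.1, t.2 ++ s.2) | t <- f, s <- g].
Definition fmono (w : fkword) : fpoly := [:: (1, w)].

(* the generator x_ij (taken to be 0 if i = j, never used in that case) *)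
Definition xg (i j : 'I_n) : fpoly :=
  match (insub (i, j) : option fkgen) with
  | Some a => fmono [:: a]
  | None => fzero
  end.

Definition is_rel (r : fpoly) : Prop :=
  (exists i j : 'I_n, i != j /\ r = fadd (xg i j) (xg j i)) \/
  (exists i j : 'I_n, i != j /\ r = fmul (xg i j) (xg i j)) \/
  (exists i j k l : 'I_n, uniq [:: i; j; k; l] /\
      r = fsub (fmul (xg i j) (xg k l)) (fmul (xg k l) (xg i j))) \/
  (exists i j k : 'I_n, uniq [:: i; j; k] /\
      r = fadd (fadd (fmul (xg i j) (xg j k)) (fmul (xg j k) (xg k i)))
               (fmul (xg k i) (xg i j))).

Definition isum (s : seq (fpoly * fpoly * fpoly)) : fpoly :=
  flatten [seq fmul t.1.1 (fmul t.1.2 t.2) | t <- s].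

Definition in_ideal (f : fpoly) : Prop :=
  exists s : seq (fpoly * fpoly * fpoly),
    (forall t, t \in s -> is_rel t.1.2) /\ forall w, fcoef f w = fcoef (isum s) w.

Definition eqFK (f g : fpoly) : Prop := in_ideal (fsub f g).

Definition lincomb (cs : seq rat) (B : seq fpoly) : fpoly :=
  flatten [seq fscale c.1 c.2 | c <- zip cs B].

Definition dimFK (S : fpoly -> Prop) (k : nat) : Prop :=
  exists B : seq fpoly,
    [/\ size B = k,
        forall b, b \in B -> S b,
        forall f, S f -> exists cs : seq rat, eqFK f (lincomb cs B) &
        forall cs : seq rat, size cs = k -> eqFK (lincomb cs B) fzero ->
          forall c, c \in cs -> c = 0].

Definition Gword (G : rel 'I_n) (w : fkword) : bool :=
  all (fun a : fkgen => G (sval a).1 (sval a).2) w.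

Definition inEG (G : rel 'I_n) (f : fpoly) : Prop :=
  exists g : fpoly, all (fun t => Gword G t.2) g /\ eqFK f g.

Definition inEGd (G : rel 'I_n) (d : nat) (f : fpoly) : Prop :=
  exists g : fpoly, all (fun t => Gword G t.2 && (size t.2 == d)) g /\ eqFK f g.

Definition findimEG (G : rel 'I_n) : Prop :=
  exists B : seq fpoly, forall f, inEG G f -> exists cs : seq rat, eqFK f (lincomb cs B).

Lemma fkgact_proof (s : {perm 'I_n}) (a : fkgen) :
  (s (sval a).1, s (sval a).2).1 != (s (sval a).1, s (sval a).2).2.
Proof. by rewrite /= (inj_eq perm_inj); case: a. Qed.

Definition fkgact (s : {perm 'I_n}) (a : fkgen) : fkgen :=
  exist (fun p : 'I_n * 'I_n => p.1 != p.2) _ (fkgact_proof s a).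

Definition tact (b a : fkgen) : fkgen := fkgact (tperm (sval b).1 (sval b).2) a.

Definition wact (w : fkword) (a : fkgen) : fkgen := foldr tact a w.

Definition fktens := seq (rat * fkword * fkword).

(* braided product (P1 (x) Q1)(P2 (x) Q2) = P1 sigma_{Q1}(P2) (x) Q1 Q2 *)
Definition tmul (T U : fktens) : fktens :=
  [seq (t.1.1 * u.1.1, t.1.2 ++ map (wact t.2) u.1.2, t.2 ++ u.2) | t <- T, u <- U].

(* coproduct on words: multiplicative extension of x -> x(x)1 + 1(x)x *)
Fixpoint cop_word (w : fkword) : fktens :=
  match w with
  | [::] => [:: (1, [::], [::])]
  | a :: w' => tmul [:: (1, [:: a], [::]); (1, [::], [:: a])] (cop_word w')
  end.

Definition cop (f : fpoly) : fktens :=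
  flatten [seq [seq (t.1 * u.1.1, u.1.2, u.2) | u <- cop_word t.2] | t <- f].

(* graded dual E_n^vee: linear functionals on E_n (given by values on words)
   vanishing on the ideal and on all degrees above some bound *)
Definition pev (p : fkword -> rat) (f : fpoly) : rat := \sum_(t <- f) t.1 * p t.2.

Definition is_dual (p : fkword -> rat) : Prop :=
  (exists D : nat, forall w : fkword, (D < size w)%N -> p w = 0) /\
  (forall f, in_ideal f -> pev p f = 0).

Definition dact (p : fkword -> rat) (f : fpoly) : fpoly :=
  [seq (u.1.1 * p u.1.2, u.2) | u <- cop f].

End FK.

(* Main.v *)
(* Everything is tested against the functionals on words that vanish on the
   ideal I of relations ("perp"): by linear algebra in each degree they separate
   the points of the free algebra modulo I, and p (x) q composed with the coproduct
   is again such a functional.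
   Let Q0 be nonzero, homogeneous, and killed on the left by all x_ij with ij in G.
   Since Delta(x Q0) = 0, the elements p * Q0 form a left ideal of E_G, and it
   contains 1, hence E_G: this is (b) for Q0 = w0, and comparing degrees shows that
   every such Q0 has degree d0. Part (a) is the top degree part of (b), (e) reads off
   the coproduct of a word, (c) multiplies Q on the left by generators until it is
   killed by all of them, (d) says that the pairing (P, Q) |-> PQ into the top degree
   has no right kernel in any degree, and (f) applies rev twice. *)
Require Import Defs.
From HB Require Import structures.
From mathcomp Require Import all_boot all_order all_algebra all_fingroup.
From mathcomp Require Import ring.
From Stdlib Require Import Classical.
Import GRing.Theory.
Set Implicit Arguments. Unset Strict Implicit.
Local Open Scope ring_scope.

(** * Evaluation of functionals on formal polynomials *)

Section Evaluation.
Variable n : nat.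
Implicit Types (p q : fkword n -> rat) (f g : fpoly n) (u v w : fkword n).
Implicit Types a b : fkgen n.

Lemma pev_add p f g : pev p (fadd f g) = pev p f + pev p g.
Proof. by rewrite /pev big_cat. Qed.

Lemma pev_scale p c f : pev p (fscale c f) = c * pev p f.
Proof. by rewrite /pev big_map mulr_sumr; apply: eq_bigr => t _; rewrite mulrA. Qed.

Lemma pev_sub p f g : pev p (fsub f g) = pev p f - pev p g.
Proof. by rewrite pev_add pev_scale mulN1r. Qed.

Lemma pev_zero p : pev p (fzero n) = 0.
Proof. by rewrite /pev big_nil. Qed.

Lemma pev_mono p w : pev p (fmono w) = p w.
Proof. by rewrite /pev big_seq1 mul1r. Qed.

Lemma eq_pev p q f : p =1 q -> pev p f = pev q f.
Proof. by move=> e; apply: eq_bigr => t _; rewrite e. Qed.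

Lemma pev_mul p f g :
  pev p (fmul f g) = pev (fun u => pev (fun v => p (u ++ v)) g) f.
Proof.
rewrite /pev /fmul big_allpairs_dep; apply: eq_bigr => t _.
by rewrite mulr_sumr; apply: eq_bigr => s _; rewrite /= mulrA.
Qed.

Lemma pev_monol p u f : pev p (fmul (fmono u) f) = pev (fun v => p (u ++ v)) f.
Proof. by rewrite pev_mul pev_mono. Qed.

Lemma pev_monor p v f : pev p (fmul f (fmono v)) = pev (fun u => p (u ++ v)) f.
Proof. by rewrite pev_mul; apply: eq_pev => u; rewrite pev_mono. Qed.

Lemma pev_lin p1 p2 c f :
  pev (fun w => p1 w + c * p2 w) f = pev p1 f + c * pev p2 f.
Proof.
by rewrite /pev mulr_sumr -big_split; apply: eq_bigr => t _ /=; ring.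
Qed.

Lemma pev_eq0 p f : (forall t, t \in f -> p t.2 = 0) -> pev p f = 0.
Proof.
by move=> h; rewrite /pev big_seq big1 // => t /h ->; rewrite mulr0.
Qed.

(** Taking a coefficient is itself the evaluation of a functional, so the linearity lemmas for [pev]
    also govern coefficients. *)
Lemma fcoefE f w : fcoef f w = pev (fun w' => (w' == w)%:R) f.
Proof.
rewrite /fcoef /pev big_mkcond; apply: eq_bigr => t _.
by case: eqP; rewrite ?mulr1 ?mulr0.
Qed.

Lemma pevE p f (s : seq (fkword n)) : uniq s ->
  (forall t, t \in f -> t.2 \in s) -> pev p f = \sum_(w <- s) fcoef f w * p w.
Proof.
move=> us fs; rewrite /pev /fcoef.
under [RHS]eq_bigr do rewrite mulr_suml big_mkcond.
rewrite exchange_big /= big_seq [RHS]big_seq; apply: eq_bigr => t tf.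
rewrite (bigD1_seq t.2) ?fs //= eqxx big1 ?addr0 // => w /negbTE.
by rewrite eq_sym => ->.
Qed.

(** Lists representing the same element of the free algebra may differ in order, repetitions and
    cancelling terms; regrouping over a duplicate-free list of all words of [f] and [g] shows that
    [pev] sees coefficients only. *)
Lemma pev_fcoef p f g : (forall w, fcoef f w = fcoef g w) -> pev p f = pev p g.
Proof.
move=> e; pose s := undup (map snd (f ++ g)).
rewrite !(@pevE _ _ s) ?undup_uniq //; first by apply: eq_bigr => w _; rewrite e.
all: by move=> t ht; rewrite mem_undup map_f // mem_cat ht ?orbT.
Qed.

(** * The two-sided ideal of relations and the functionals that vanish on it *)

Lemma in_ideal_ext f g : in_ideal f -> (forall w, fcoef g w = fcoef f w) -> in_ideal g.
Proof. by case=> s [hs e] e'; exists s; split=> // w; rewrite e' e. Qed.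

Lemma isum_cat s1 s2 : isum (s1 ++ s2) = fadd (isum s1) (isum s2) :> fpoly n.
Proof. by rewrite /isum map_cat flatten_cat. Qed.

Lemma in_ideal0 : in_ideal (fzero n).
Proof. by exists [::]; split. Qed.

Lemma in_idealD f g : in_ideal f -> in_ideal g -> in_ideal (fadd f g).
Proof.
move=> [s [hs e]] [s' [hs' e']]; exists (s ++ s'); split=> [t|w].
  by rewrite mem_cat => /orP[/hs|/hs'].
by rewrite isum_cat !fcoefE !pev_add -!fcoefE e e'.
Qed.

Lemma pev_isum p (s : seq (fpoly n * fpoly n * fpoly n)) :
  pev p (isum s) = \sum_(t <- s) pev p (fmul t.1.1 (fmul t.1.2 t.2)).
Proof.
elim: s => [|t s IH]; first by rewrite big_nil /isum /= pev_zero.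
by rewrite big_cons -IH -pev_add.
Qed.

Lemma in_idealZ c f : in_ideal f -> in_ideal (fscale c f).
Proof.
move=> [s [hs e]]; exists [seq (fscale c t.1.1, t.1.2, t.2) | t <- s]; split.
  by move=> t /mapP[t' /hs ? ->].
move=> w; rewrite !fcoefE pev_scale -!fcoefE e !fcoefE !pev_isum big_map mulr_sumr.
by apply: eq_bigr => t _; rewrite /= !pev_mul pev_scale.
Qed.

Lemma in_ideal_mono u r v : is_rel r ->
  in_ideal (fmul (fmono u) (fmul r (fmono v))).
Proof.
move=> hr; exists [:: (fmono u, r, fmono v)]; split.
  by move=> t; rewrite inE => /eqP ->.
by move=> w; rewrite /isum /= cats0.
Qed.

(** The products [u r v] with words [u], [v] span the ideal. No degree bound is imposed, unlike in
    [is_dual]. *)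
Definition perp p : Prop := forall r, is_rel r -> forall u v,
  pev p (fmul (fmono u) (fmul r (fmono v))) = 0.

Lemma perp_ideal p f : perp p -> in_ideal f -> pev p f = 0.
Proof.
move=> pp [s [hs e]]; rewrite (pev_fcoef p e) pev_isum big_seq big1 // => t ts.
rewrite pev_mul; apply: pev_eq0 => -[x u] _ /=.
(* Exchanging the sums over the relation and over the right factor makes both outer factors
   monomials. *)
have -> : pev (fun v => p (u ++ v)) (fmul t.1.2 t.2) =
          pev (fun v => pev p (fmul (fmono u) (fmul t.1.2 (fmono v)))) t.2.
  rewrite pev_mul /pev.
  under eq_bigr do rewrite mulr_sumr.
  rewrite exchange_big; apply: eq_bigr => t' _ /=.
  rewrite -/(pev _ _) pev_monol pev_monor /pev mulr_sumr.
  by apply: eq_bigr => t'' _; ring.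
by apply: pev_eq0 => t' _; apply: pp (hs _ ts) _ _.
Qed.

Lemma perp_eqFK p f g : perp p -> eqFK f g -> pev p f = pev p g.
Proof. by move=> pp /(perp_ideal pp); rewrite pev_sub => /subr0_eq. Qed.

Definition flip a : fkgen n :=
  exist (fun p : 'I_n * 'I_n => p.1 != p.2) ((sval a).2, (sval a).1)
    (etrans (congr1 negb (eq_sym _ _)) (svalP a)).

Definition disj a b := uniq [:: (sval a).1; (sval a).2; (sval b).1; (sval b).2].
(** The triples x_ij, x_jk, x_ki; distinctness of i, j, k is automatic because each generator has
    two different indices. *)
Definition cyc a b (c : fkgen n) :=
  [&& (sval a).2 == (sval b).1, (sval b).2 == (sval c).1 & (sval c).2 == (sval a).1].

Lemma xgE a : xg (sval a).1 (sval a).2 = fmono [:: a].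
Proof.
rewrite /xg -surjective_pairing.
by rewrite (valK a : insub (sval a) = Some a).
Qed.

Lemma xg_sval i j a : sval a = (i, j) -> xg i j = fmono [:: a].
Proof. by rewrite -xgE => ->. Qed.

Lemma fkgen_mk i j : i != j -> exists a : fkgen n, sval a = (i, j).
Proof. by move=> ij; exists (exist (fun z : 'I_n * 'I_n => z.1 != z.2) (i, j) ij). Qed.

(** The four families of relations become identities on neighbouring letters of a word, so that
    closure properties of [perp] are checked locally. *)
Lemma perpP p : perp p <->
  [/\ forall u v a, p (u ++ flip a :: v) = - p (u ++ a :: v),
      forall u v a, p (u ++ [:: a, a & v]) = 0,
      forall u v a b, disj a b -> p (u ++ [:: a, b & v]) = p (u ++ [:: b, a & v]) &
      forall u v a b c, cyc a b c ->
        p (u ++ [:: a, b & v]) + p (u ++ [:: b, c & v]) + p (u ++ [:: c, a & v]) = 0].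
Proof.
have m2 a b : fmul (fmono [:: a]) (fmono [:: b]) = fmono [:: a; b] by [].
split=> [pp|[h1 h2 h3 h4] r].
  split=> [u v a|u v a|u v a b ab|u v a b c /and3P[/eqP ab /eqP bc /eqP ca]].
  - have r : is_rel (fadd (fmono [:: a]) (fmono [:: flip a])).
      by left; exists (sval a).1, (sval a).2; rewrite -(xgE a) -(xgE (flip a)); split=> //; apply: svalP a.
    have := pp _ r u v; rewrite pev_monol pev_monor pev_add !pev_mono.
    by move/eqP; rewrite addrC addr_eq0 => /eqP.
  - have r : is_rel (fmul (fmono [:: a]) (fmono [:: a])).
      by right; left; exists (sval a).1, (sval a).2; rewrite -(xgE a); split=> //; apply: svalP a.
    by have := pp _ r u v; rewrite m2 pev_monol pev_monor !pev_mono.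
  - have r : is_rel (fsub (fmono [:: a; b]) (fmono [:: b; a])).
      by do 2 right; left; exists (sval a).1, (sval a).2, (sval b).1, (sval b).2;
        rewrite !xgE.
    have := pp _ r u v; rewrite pev_monol pev_monor pev_sub !pev_mono.
    by move/subr0_eq.
  - have r : is_rel (fadd (fadd (fmono [:: a; b]) (fmono [:: b; c])) (fmono [:: c; a])).
      do 3 right; exists (sval a).1, (sval b).1, (sval c).1.
      rewrite (@xg_sval _ _ a) -?ab -?surjective_pairing //.
      rewrite ab (@xg_sval _ _ b) -?bc -?surjective_pairing //.
      rewrite bc (@xg_sval _ _ c) -?ca -?surjective_pairing //; split=> //=.
      rewrite ca !inE !negb_or -{1}ab (svalP a : _ != _) eq_sym -{1}ca.
      by rewrite (svalP c : _ != _) -bc (svalP b : _ != _).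
    by have := pp _ r u v; rewrite pev_monol pev_monor !pev_add !pev_mono.
case=> [[i [j [ij ->]]]|[[i [j [ij ->]]]|[[i [j [k [l [U ->]]]]]|[i [j [k [U ->]]]]]]] u v.
- have [a ea] := fkgen_mk ij.
  have := xgE a; have := xgE (flip a); rewrite /= ea /= => -> ->.
  by rewrite pev_monol pev_monor pev_add !pev_mono /= h1 addrN.
- have [a ea] := fkgen_mk ij; have := xgE a; rewrite ea /= => ->.
  by rewrite m2 pev_monol pev_monor !pev_mono h2.
- move: (U); rewrite /= !inE !negb_or => /and4P[/and3P[ij _ _] _ kl _].
  have [a ea] := fkgen_mk ij; have [b eb] := fkgen_mk kl.
  have := xgE a; have := xgE b; rewrite ea eb /= => -> ->.
  by rewrite !m2 pev_monol pev_monor pev_sub !pev_mono /= h3 ?subrr // /disj ea eb.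
- move: (U); rewrite /= !inE !negb_or => /and3P[/andP[ij ik] jk _].
  rewrite eq_sym in ik.
  have [a ea] := fkgen_mk ij; have [b eb] := fkgen_mk jk; have [c ec] := fkgen_mk ik.
  have := xgE a; have := xgE b; have := xgE c; rewrite ea eb ec /= => -> -> ->.
  by rewrite !m2 pev_monol pev_monor !pev_add !pev_mono /= h4 // /cyc ea eb ec !eqxx.
Qed.

End Evaluation.

(** * The coproduct *)

Section Coproduct.
Variable n : nat.
Implicit Types (p q : fkword n -> rat) (f g : fpoly n) (u v w : fkword n).
Implicit Types a b : fkgen n.

Lemma perp_ext p q : p =1 q -> perp p -> perp q.
Proof. by move=> e pp r hr u v; rewrite -(eq_pev _ e) pp. Qed.

Lemma perp_lin p q (c : rat) : perp p -> perp q -> perp (fun w => p w + c * q w).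
Proof. by move=> pp pq r hr u v; rewrite pev_lin pp // pq // mulr0 addr0. Qed.

(** The dual form of the ideal being two-sided. *)
Lemma perp_ctx p u v : perp p -> perp (fun w => p (u ++ w ++ v)).
Proof.
move=> /perpP[h1 h2 h3 h4]; apply/perpP; split.
- by move=> u' v' a; rewrite -!catA !cat_cons !(catA u) h1.
- by move=> u' v' a; rewrite -!catA !cat_cons !(catA u) h2.
- by move=> u' v' a b ab; rewrite -!catA !cat_cons !(catA u) h3.
- by move=> u' v' a b c abc; rewrite -!catA !cat_cons !(catA u) h4.
Qed.

Lemma perp_cons p a : perp p -> perp (fun w => p (a :: w)).
Proof. by move/(perp_ctx [:: a] [::]); apply: perp_ext => w; rewrite /= cats0. Qed.

Lemma fkgen_inj a b : sval a = sval b -> a = b.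
Proof. exact: val_inj. Qed.

Lemma flip_act s a : fkgact s (flip a) = flip (fkgact s a).
Proof. exact: fkgen_inj. Qed.

Lemma perp_act p s : perp p -> perp (fun w => p (map (fkgact s) w)).
Proof.
move=> /perpP[h1 h2 h3 h4]; apply/perpP; split.
- by move=> u v a; rewrite !map_cat /= flip_act h1.
- by move=> u v a; rewrite !map_cat /= h2.
- move=> u v a b ab; rewrite !map_cat /= h3 // /disj.
  rewrite -[X in uniq X]/(map s [:: (sval a).1; (sval a).2; (sval b).1; (sval b).2]).
  by rewrite (map_inj_uniq perm_inj).
- move=> u v a b c /and3P[ab bc ca]; rewrite !map_cat /= h4 // /cyc /=.
  by rewrite !(inj_eq perm_inj) ab bc ca.
Qed.

Lemma disjC a b : disj a b -> disj b a.
Proof. by rewrite /disj -(rot_uniq 2). Qed.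

Lemma perp_rev p : perp p -> perp (fun w => p (rev w)).
Proof.
have r1 u v a : rev (u ++ a :: v) = rev v ++ a :: rev u.
  by rewrite rev_cat rev_cons cat_rcons.
have r2 u v a b : rev (u ++ [:: a, b & v]) = rev v ++ [:: b, a & rev u].
  by rewrite rev_cat !rev_cons !cat_rcons.
move=> /perpP[h1 h2 h3 h4]; apply/perpP; split.
- by move=> u v a; rewrite !r1 h1.
- by move=> u v a; rewrite !r2 h2.
- by move=> u v a b ab; rewrite !r2 h3 // disjC.
(* Flipping two adjacent letters costs two signs, hence nothing. It turns the reversed pairs ba, ac,
   cb into the pairs of a cycle of flipped generators. *)
- have f2 u v a b : p (u ++ [:: flip a, flip b & v]) = p (u ++ [:: a, b & v]).
    by rewrite h1 -cat_rcons h1 opprK cat_rcons.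
  move=> u v a b c /and3P[ab bc ca]; rewrite !r2.
  rewrite -(f2 _ _ b) -(f2 _ _ c) -(f2 _ _ a) -addrA [X in _ + X]addrC addrA h4 //.
  by apply/and3P; split; rewrite /= eq_sym.
Qed.

Definition at_size d p w : rat := if size w == d then p w else 0.

(** The relations are homogeneous: each identity of [perpP] compares words of equal length. *)
Lemma perp_at_size d p : perp p -> perp (at_size d p).
Proof.
move=> /perpP[h1 h2 h3 h4]; apply/perpP; rewrite /at_size; split.
- by move=> u v a; rewrite !size_cat /= h1; case: ifP; rewrite ?oppr0.
- by move=> u v a; rewrite h2 if_same.
- by move=> u v a b ab; rewrite !size_cat /= h3.
- by move=> u v a b c abc; rewrite !size_cat /=; case: ifP; rewrite ?h4 ?addr0.
Qed.

(* The value of p (x) q on the coproduct of the word w. *)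
Definition cobil p q w : rat := \sum_(t <- cop_word w) t.1.1 * p t.1.2 * q t.2.

(** Testing [dact p f] against [q] amounts to evaluating [p] tensor [q] on the coproduct of [f];
    this is how every p * f is handled below. *)
Lemma pev_dact p q f : pev q (dact p f) = pev (cobil p q) f.
Proof.
rewrite /pev /dact /cop big_map big_flatten big_map; apply: eq_bigr => t _ /=.
by rewrite /cobil mulr_sumr big_map; apply: eq_bigr => u _ /=; ring.
Qed.

Lemma cobil_nil p q : cobil p q [::] = p [::] * q [::].
Proof. by rewrite /cobil big_seq1 mul1r. Qed.

(** Expands the braided product by the two terms of the coproduct of [a]: moving [a] past the left
    tensor factor applies its transposition to that factor. *)
Lemma cobil_cons p q a w :
  cobil p q (a :: w) =
  cobil (fun v => p (a :: v)) q w + cobil (fun v => p (map (tact a) v)) (fun v => q (a :: v)) w.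
Proof.
rewrite /cobil /= /tmul big_allpairs_dep big_cons big_seq1; congr (_ + _);
  apply: eq_bigr => t _ /=; rewrite mul1r // map_id_in //.
Qed.

Lemma eq_cobil p p' q q' w : p =1 p' -> q =1 q' -> cobil p q w = cobil p' q' w.
Proof. by move=> e e'; apply: eq_bigr => t _; rewrite e e'. Qed.

Lemma cobil0l p q w : (forall v, p v = 0) -> cobil p q w = 0.
Proof. by move=> e; rewrite /cobil big1 // => t _; rewrite e mulr0 mul0r. Qed.

Lemma cobil0r p q w : (forall v, q v = 0) -> cobil p q w = 0.
Proof. by move=> e; rewrite /cobil big1 // => t _; rewrite e mulr0. Qed.

Lemma cobilDl p1 p2 q w : cobil (fun v => p1 v + p2 v) q w = cobil p1 q w + cobil p2 q w.
Proof. by rewrite /cobil -big_split; apply: eq_bigr => t _ /=; ring. Qed.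

Lemma cobilDr p q1 q2 w : cobil p (fun v => q1 v + q2 v) w = cobil p q1 w + cobil p q2 w.
Proof. by rewrite /cobil -big_split; apply: eq_bigr => t _ /=; ring. Qed.

Lemma cobilNl p q w : cobil (fun v => - p v) q w = - cobil p q w.
Proof. by rewrite /cobil -sumrN; apply: eq_bigr => t _ /=; ring. Qed.

Lemma cobilNr p q w : cobil p (fun v => - q v) w = - cobil p q w.
Proof. by rewrite /cobil -sumrN; apply: eq_bigr => t _ /=; ring. Qed.

(** * The action of the transposition of a generator on the generators *)

Lemma tact_flip a : tact (flip a) =1 tact a.
Proof. by move=> b; apply: fkgen_inj; rewrite /tact /= tpermC. Qed.

Lemma tactK a : involutive (tact a).
Proof.
by move=> b; apply: fkgen_inj; rewrite /tact /= !tpermK -surjective_pairing.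
Qed.

Lemma tact_disj a b : disj a b -> tact a b = b.
Proof.
rewrite /disj /= !inE !negb_or => /and4P[/and3P[_ h1 h2] /andP[h3 h4] _ _].
by apply: fkgen_inj; rewrite /= !tpermD // -surjective_pairing.
Qed.

Lemma tact_self a : tact a a = flip a.
Proof. by apply: fkgen_inj; rewrite /= tpermL tpermR. Qed.

(** With [a], [b], [c] equal to x_ij, x_jk, x_ki, the transposition of i and j sends x_jk to
    x_ik. *)
Lemma tact_cyc a b c : cyc a b c -> tact a b = flip c.
Proof.
move=> /and3P[/eqP ab /eqP bc /eqP ca]; apply: fkgen_inj.
rewrite /= -ab tpermR ca bc tpermD // -?ca.
  by rewrite eq_sym (svalP c : _ != _).
by rewrite ab -bc (svalP b : _ != _).
Qed.

Lemma cycC a b c : cyc a b c -> cyc b c a.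
Proof. by case/and3P=> ab bc ca; apply/and3P. Qed.

Lemma act_tact (s : {perm 'I_n}) a b :
  fkgact s (tact a b) = tact (fkgact s a) (fkgact s b).
Proof.
by apply: fkgen_inj; congr (_, _); exact: (inj_tperm _ _ _ (@perm_inj _ s)).
Qed.

(** Writing s_a for the transposition of [a], conjugation gives s_a s_b = s_{s_a(b)} s_a, and s_a(b)
    is [flip c], which has the transposition of [c]. *)
Lemma tact_cyc_comp a b c e : cyc a b c -> tact a (tact b e) = tact c (tact a e).
Proof.
by move=> h; rewrite {1}/tact act_tact -!/(tact a _) (tact_cyc h) tact_flip.
Qed.

Lemma tact_disj_comp a b e : disj a b -> tact a (tact b e) = tact b (tact a e).
Proof.
by move=> h; rewrite {1}/tact act_tact -!/(tact a _) (tact_disj h).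
Qed.

(* The coproduct maps I to I (x) F + F (x) I: on a relation, the part of
   bidegree (1,1) lies in I (x) F, and the monomials of a relation all have the
   same S_n-degree. *)
Lemma perp_cobil p q : perp p -> perp q -> perp (cobil p q).
Proof.
move=> pp pq; apply/perpP.
(* The four terms have bidegrees (2,0), (1,1), (1,1), (0,2) in the two letters. *)
have cobil2 p' q' a b v : cobil p' q' [:: a, b & v] =
   cobil (fun w => p' [:: a, b & w]) q' v
 + cobil (fun w => p' (a :: map (tact b) w)) (fun w => q' (b :: w)) v
 + cobil (fun w => p' (tact a b :: map (tact a) w)) (fun w => q' (a :: w)) v
 + cobil (fun w => p' (map (tact a) (map (tact b) w))) (fun w => q' [:: a, b & w]) v.
  by rewrite !cobil_cons /= !addrA.
split.
(* Peeling a letter off the left context changes both functionals, so the induction runs over all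
   pairs in [perp]; likewise for the other three relations. *)
- move=> u v a; elim: u p q pp pq => [|x u IH] p q pp pq; last first.
    rewrite !cat_cons !cobil_cons !IH ?opprD //; try exact: perp_cons.
    exact: perp_act.
  have /perpP[h _ _ _] := pp; have /perpP[k _ _ _] := pq.
  rewrite !cobil_cons opprD -cobilNl -cobilNr; congr (_ + _); apply: eq_cobil => w //.
  - exact: (h [::]).
  - by rewrite (eq_map (tact_flip a)).
  - exact: (k [::]).
- move=> u v a; elim: u p q pp pq => [|x u IH] p q pp pq; last first.
    rewrite !cat_cons !cobil_cons !IH ?addr0 //; try exact: perp_cons.
    exact: perp_act.
  have /perpP[h1 h2 _ _] := pp; have /perpP[_ k2 _ _] := pq.
  rewrite cobil2 cobil0l ?add0r => [|w]; last exact: (h2 [::]).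
  rewrite [X in _ + X]cobil0r ?addr0 => [|w]; last exact: (k2 [::]).
  (* The two terms of bidegree (1,1) start with [a] and [flip a] on the left and cancel. *)
  rewrite -cobilDl cobil0l // => w; rewrite tact_self.
  by rewrite (h1 [::]) addrN.
- move=> u v a b ab; elim: u p q pp pq => [|x u IH] p q pp pq; last first.
    rewrite !cat_cons !cobil_cons !IH //; try exact: perp_cons.
    exact: perp_act.
  have /perpP[_ _ h3 _] := pp; have /perpP[_ _ k3 _] := pq.
  rewrite /= !cobil2 (tact_disj ab) (tact_disj (disjC ab)).
  (* Exchanging [a] and [b] swaps the two terms of bidegree (1,1). *)
  rewrite [in LHS](addrAC (cobil _ _ _)); congr (_ + _ + _ + _).
    by apply: eq_cobil => // w; apply: (h3 [::]).
  apply: eq_cobil => w; last exact: (k3 [::]).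
  by rewrite -!map_comp; congr p; apply: eq_map => e; apply: tact_disj_comp.
- move=> u v a b c abc; elim: u p q pp pq => [|x u IH] p q pp pq; last first.
    have e (x1 x2 x3 y1 y2 y3 : rat) : x1 + y1 + (x2 + y2) + (x3 + y3) =
      (x1 + x2 + x3) + (y1 + y2 + y3) by ring.
    rewrite !cat_cons !cobil_cons e !IH ?addr0 //; try exact: perp_cons.
    exact: perp_act.
  have /perpP[h1 _ _ h4] := pp; have /perpP[_ _ _ k4] := pq.
  have bca := cycC abc; have cab := cycC bca.
  rewrite /= !cobil2 (tact_cyc abc) (tact_cyc bca) (tact_cyc cab).
  set A1 := cobil _ q v; set A2 := cobil _ _ v.
  set A3 := cobil _ _ v; set A4 := cobil _ _ v.
  set B1 := cobil _ q v; set B2 := cobil _ _ v.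
  set B3 := cobil _ _ v; set B4 := cobil _ _ v.
  set C1 := cobil _ q v; set C2 := cobil _ _ v.
  set C3 := cobil _ _ v; set C4 := cobil _ _ v.
  have e1 : A1 + B1 + C1 = 0.
    by rewrite -!cobilDl cobil0l // => w; apply: (h4 [::]).
  (* The terms of bidegree (1,1) cancel in pairs with the same letter in the right factor: the left
     factors start with a generator and its flip. *)
  have e2 : A2 + B3 = 0.
    by rewrite -cobilDl cobil0l // => w; rewrite (h1 [::]) addrN.
  have e3 : B2 + C3 = 0.
    by rewrite -cobilDl cobil0l // => w; rewrite (h1 [::]) addrN.
  have e4 : C2 + A3 = 0.
    by rewrite -cobilDl cobil0l // => w; rewrite (h1 [::]) addrN.
  (* The left factors are acted on by s_a s_b, s_b s_c and s_c s_a, which coincide, so the relation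
     applies to [q]. *)
  have e5 : A4 + B4 + C4 = 0.
    have -> : B4 = cobil (fun w => p (map (tact a) (map (tact b) w)))
                    (fun w => q [:: b, c & w]) v.
      apply: eq_cobil => // w; rewrite -!map_comp; congr p.
      by apply: eq_map => e; apply: tact_cyc_comp.
    have -> : C4 = cobil (fun w => p (map (tact a) (map (tact b) w)))
                    (fun w => q [:: c, a & w]) v.
      apply: eq_cobil => // w; rewrite -!map_comp; congr p.
      by apply: eq_map => e; rewrite /= (tact_cyc_comp _ abc).
    by rewrite -!cobilDr cobil0r // => w; apply: (k4 [::]).
  have -> : A1 + A2 + A3 + A4 + (B1 + B2 + B3 + B4) + (C1 + C2 + C3 + C4) =
    (A1 + B1 + C1) + (A2 + B3) + (B2 + C3) + (C2 + A3) + (A4 + B4 + C4) by ring.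
  by rewrite e1 e2 e3 e4 e5 !addr0.
Qed.

End Coproduct.

(** * Separation of points *)

(** Starting from 0, a row space inside [S] is enlarged by a vector of [S] outside it, as long as
    there is one; whether there is one is decided classically. In the induction, [k] bounds how
    often the rank can still grow. *)
Lemma subspace_mx (F : fieldType) (N : nat) (S : 'rV[F]_N -> Prop) :
  S 0 -> (forall x y, S x -> S y -> S (x + y)) -> (forall c x, S x -> S (c *: x)) ->
  exists A : 'M[F]_N, forall v, (v <= A)%MS <-> S v.
Proof.
move=> S0 SD SZ.
suff H k (A : 'M[F]_N) : (forall v, (v <= A)%MS -> S v) -> (N <= \rank A + k)%N ->
    exists A' : 'M[F]_N, forall v, (v <= A')%MS <-> S v.
  apply: (H N 0) => [v|]; last exact: leq_addl.
  by rewrite submx0 => /eqP ->.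
elim: k A => [|k IH] A SA hk.
  exists A => v; split; first exact: SA.
  by move=> _; rewrite submx_full // /row_full eqn_leq rank_leq_col -(addn0 (\rank A)).
case: (classic (exists v, S v /\ ~~ (v <= A)%MS)) => [[v [Sv vA]]|h]; last first.
  exists A => v; split; first exact: SA.
  by move=> Sv; apply: NNPP => /negP nv; apply: h; exists v.
apply: (IH (A + v)%MS) => [w /sub_addsmxP[[c d] /= ->]|].
  apply: SD; first by apply/SA/submxMl.
  by rewrite (mx11_scalar d) mul_scalar_mx; apply: SZ.
apply: leq_trans hk _; rewrite addnS -addSn leq_add2r.
have : (A < A + v)%MS.
  by rewrite ltmxE addsmxSl; apply: contra vA => /(submx_trans (addsmxSr A v)).
exact: rank_ltmx.
Qed.

Section Separation.
Variable n : nat.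
Implicit Types (p q : fkword n -> rat) (f g : fpoly n) (u v w : fkword n).
Implicit Types a b : fkgen n.

Definition component d f : fpoly n := [seq t <- f | size t.2 == d].

Lemma pev_component p d f : pev p (component d f) = pev (at_size d p) f.
Proof.
rewrite /pev big_filter big_mkcond; apply: eq_bigr => t _.
by rewrite /at_size; case: ifP; rewrite ?mulr0.
Qed.

(** Coordinates on the finite-dimensional degree [d] part of the free algebra, so that matrix
    algebra applies to it. *)
Definition wordpoly d (x : 'rV[rat]_#|{: d.-tuple (fkgen n)}|) : fpoly n :=
  [seq (x 0 (enum_rank t), val t) | t <- enum {: d.-tuple (fkgen n)}].

Lemma pev_wordpoly p d (x : 'rV[rat]_#|{: d.-tuple (fkgen n)}|) :
  pev p (wordpoly x) = \sum_(t : d.-tuple (fkgen n)) x 0 (enum_rank t) * p t.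
Proof. by rewrite /pev big_map big_enum. Qed.

Definition wordrow d f : 'rV[rat]_#|{: d.-tuple (fkgen n)}| :=
  \row_j fcoef f (enum_val j : d.-tuple (fkgen n)).

Lemma fcoef_component d f w :
  fcoef (component d f) w =
  fcoef (wordpoly (wordrow d f)) w.
Proof.
rewrite !fcoefE pev_component pev_wordpoly.
under eq_bigr do rewrite mxE enum_rankK.
case: (eqVneq (size w) d) => [e|ne].
  rewrite (bigD1 (Tuple (introT eqP e))) //= eqxx mulr1 big1 ?addr0.
    rewrite fcoefE; apply: eq_pev => w'; rewrite /at_size.
    by case: eqP => // ne; case: eqP => // ew; rewrite ew e in ne.
  move=> t /negP nt; case: eqP; rewrite ?mulr0 // => et.
  by case: nt; apply/eqP/val_inj.
rewrite big1 => [|t _].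
  apply: pev_eq0 => t _; rewrite /at_size; case: ifP => // et.
  by case: eqP => // e; rewrite -e et in ne.
by case: eqP; rewrite ?mulr0 // => e; rewrite -e size_tuple eqxx in ne.
Qed.

(** An element is the sum of its components up to the maximal length of its words. *)
Lemma ideal_components f : (forall d, in_ideal (component d f)) -> in_ideal f.
Proof.
move=> h; pose N := (\max_(t <- f) size t.2).+1.
apply: (@in_ideal_ext _ (flatten [seq component d f | d <- iota 0 N])) => [|w].
  elim: (iota 0 N) => [|d s IH]; first exact: in_ideal0.
  exact: (in_idealD (h d) IH).
rewrite !fcoefE; set p := fun w' : fkword n => _.
have -> : pev p (flatten [seq component d f | d <- iota 0 N]) =
   \sum_(d <- iota 0 N) pev (at_size d p) f.
  elim: (iota 0 N) => [|d s IH]; first by rewrite big_nil /pev big_nil.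
  by rewrite big_cons -IH -pev_component -pev_add.
rewrite /pev exchange_big big_seq [RHS]big_seq; apply: eq_bigr => t tf /=.
have mt : size t.2 \in iota 0 N 
  by rewrite mem_iota ltnS /= (@leq_bigmax_seq _ f xpredT (fun t => size t.2)).
rewrite -mulr_sumr (bigD1_seq _ mt (iota_uniq _ _)) /= /at_size eqxx big1 ?addr0 //.
by move=> i /negbTE; rewrite eq_sym => ->.
Qed.

Lemma rel_homog r : @is_rel n r -> exists k, forall t, t \in r -> size t.2 = k.
Proof.
have x1 i j t : t \in xg i j -> size (t.2 : fkword n) = 1%N.
  by rewrite /xg; case: insub => // a; rewrite inE => /eqP ->.
have x2 i j k l t : t \in fmul (xg i j) (xg k l) -> size (t.2 : fkword n) = 2%N.
  by case/allpairsP=> -[s s'] [/= /x1 h /x1 h' ->]; rewrite size_cat h h'.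
case=> [[i [j [ij ->]]]|[[i [j [ij ->]]]|[[i [j [k [l [U ->]]]]]|[i [j [k [U ->]]]]]]].
- by exists 1%N => t; rewrite mem_cat => /orP[] /x1.
- by exists 2%N => t /x2.
- exists 2%N => t; rewrite mem_cat => /orP[/x2 //|/mapP[s /x2 h ->]] //.
- by exists 2%N => t; rewrite !mem_cat => /orP[/orP[]|] /x2.
Qed.

(** Some component of [f], of degree [d], is outside the ideal. The degree [d] part of the ideal is
    the row space of a matrix [A]; a column of the cokernel of [A] that does not kill this
    component, extended by zero to other degrees, is the functional. *)
Lemma perp_separation f : ~ in_ideal f ->
  exists d p, [/\ perp p, forall w, size w != d -> p w = 0 & pev p f != 0].
Proof.
move=> nf; have [d nd] : exists d, ~ in_ideal (component d f).
  by apply: not_all_ex_not => /ideal_components.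
pose S x := in_ideal (@wordpoly d x).
have [|x y Sx Sy|c x Sx|A SA] := @subspace_mx _ _ S.
- apply: (in_ideal_ext (in_ideal0 n)) => w; rewrite !fcoefE pev_wordpoly pev_zero big1 // => t _.
  by rewrite mxE mul0r.
- apply: (in_ideal_ext (in_idealD Sx Sy)) => w.
  rewrite !fcoefE pev_add !pev_wordpoly -big_split; apply: eq_bigr => t _ /=.
  by rewrite mxE mulrDl.
- apply: (in_ideal_ext (in_idealZ c Sx)) => w.
  rewrite !fcoefE pev_scale !pev_wordpoly mulr_sumr; apply: eq_bigr => t _ /=.
  by rewrite mxE mulrA.
pose vf := wordrow d f.
have nvf : ~~ (vf <= A)%MS.
  by apply/negP => /SA h; apply: nd; apply: (in_ideal_ext h) => w; apply: fcoef_component.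
rewrite submxE in nvf.
have [j hj] : exists j, (vf *m cokermx A) 0 j != 0.
  apply/existsP; apply: contraR nvf; rewrite negb_exists => /forallP h.
  by apply/eqP/rowP => j; have := h j; rewrite negbK => /eqP ->; rewrite mxE.
pose p w := if (insub w : option (d.-tuple (fkgen n))) is Some t
            then cokermx A (enum_rank t) j else 0.
have pE x : pev p (wordpoly x) = (x *m cokermx A) 0 j.
  rewrite pev_wordpoly mxE [RHS](reindex (@enum_rank {: d.-tuple (fkgen n)})) /=.
    by apply: eq_bigr => t _; rewrite /p valK.
  by apply: onW_bij; apply: enum_rank_bij.
have p0 w : size w != d -> p w = 0 by move=> /negbTE h; rewrite /p insubF.
exists d, p; split=> //; last first.
  suff -> : pev p f = pev p (component d f).
    by rewrite (pev_fcoef p (fcoef_component d f)) pE.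
  rewrite pev_component; apply: eq_pev => w; rewrite /at_size.
  by case: ifP => // /negbT /p0.
(* The product [u r v] is homogeneous: in a degree other than [d] the functional is zero, in degree
   [d] its coordinates lie in the row space of [A]. *)
move=> r hr u v; have [k hk] := rel_homog hr.
set g := fmul _ _; have hI : in_ideal g by apply: in_ideal_mono.
have hg t : t \in g -> size t.2 = (size u + (k + size v))%N.
  case/allpairsP=> -[s s'] [/=]; rewrite inE => /eqP -> /allpairsP[[x x'] [/= /hk hx]].
  by rewrite inE => /eqP -> -> -> /=; rewrite !size_cat hx.
case: (eqVneq (size u + (k + size v))%N d) => [e|ne]; last first.
  by apply: pev_eq0 => t /hg h; rewrite p0 // h.
have cg : component d g = g by apply/all_filterP/allP => t /hg ->; rewrite e.
rewrite -cg (pev_fcoef p (fcoef_component d g)) pE.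
have /SA : S (wordrow d g).
  by apply: (in_ideal_ext hI) => w; rewrite -fcoef_component cg.
by rewrite submxE => /eqP ->; rewrite mxE.
Qed.

Lemma eqFKP f g : eqFK f g <-> forall p, perp p -> pev p f = pev p g.
Proof.
split=> [h p pp|h]; first exact: perp_eqFK.
apply: NNPP => /perp_separation[d [p [pp _]]].
by rewrite pev_sub h // subrr eqxx.
Qed.

Lemma eqFK0P f : eqFK f (fzero n) <-> forall p, perp p -> pev p f = 0.
Proof. by rewrite eqFKP; split=> h p pp; have := h p pp; rewrite pev_zero. Qed.

Lemma neqFK0 f : ~ eqFK f (fzero n) ->
  exists d p, [/\ perp p, forall w, size w != d -> p w = 0 & pev p f = 1].
Proof.
move=> nf; have [|d [p [pp p0 pf]]] := @perp_separation f.
  by move=> hf; apply: nf; apply/eqFK0P => p pp; apply: perp_ideal.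
(* The summand 0 gives the shape required by [perp_lin] and [pev_lin]. *)
exists d, (fun w => 0 + (pev p f)^-1 * p w); split.
- have pz : perp (fun _ : fkword n => 0).
    by move=> r _ u v; apply: pev_eq0.
  exact: perp_lin.
- by move=> w /p0 ->; rewrite mulr0 addr0.
- by rewrite (pev_lin (fun _ => 0)) pev_eq0 // add0r mulVf.
Qed.

End Separation.

(** * Elements killed on the left by the generators *)

Section Coideal.
Variable n : nat.
Implicit Types (p q : fkword n -> rat) (f g Q : fpoly n) (u v w : fkword n).
Implicit Types a b : fkgen n.

(** No tensor factor in the coproduct of [w] is longer than [w]. *)
Lemma cobil_lowl p q w : (forall v, (size v <= size w)%N -> p v = 0) -> cobil p q w = 0.
Proof.
elim: w p q => [|a w IH] p q p0; first by rewrite cobil_nil p0 // mul0r.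
by rewrite cobil_cons !IH ?addr0 // => v hv; apply: p0; rewrite ?size_map // ltnW.
Qed.

Lemma cobil_lowr p q w : (forall v, (size v <= size w)%N -> q v = 0) -> cobil p q w = 0.
Proof.
elim: w p q => [|a w IH] p q q0; first by rewrite cobil_nil q0 // mulr0.
by rewrite cobil_cons !IH ?addr0 // => v hv; apply: q0; rewrite // ltnW.
Qed.

(** The only term whose left factor has full length is [w] tensor 1; on the right, it is 1 tensor
    [w]. *)
Lemma cobil_topl p q w : (forall v, (size v < size w)%N -> p v = 0) ->
  cobil p q w = p w * q [::].
Proof.
elim: w p => [|a w IH] p p0; first by rewrite cobil_nil.
rewrite cobil_cons IH => [|v hv]; last exact: p0.
by rewrite cobil_lowl ?addr0 // => v hv; apply: p0; rewrite size_map.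
Qed.

Lemma cobil_topr p q w : (forall v, (size v < size w)%N -> q v = 0) ->
  cobil p q w = p [::] * q w.
Proof.
elim: w p q => [|a w IH] p q q0; first by rewrite cobil_nil.
rewrite cobil_cons cobil_lowr ?add0r => [|v hv]; last exact: q0.
by rewrite IH //= => v hv; apply: q0.
Qed.

Definition homog d f := all (fun t : rat * fkword n => size t.2 == d) f.
Definition Gpoly (G : rel 'I_n) f := all (fun t : rat * fkword n => Gword G t.2) f.

(** The left socle: elements annihilated by all of E_G^+ acting on the left. *)
Definition ltop (G : rel 'I_n) Q : Prop :=
  forall a, G (sval a).1 (sval a).2 -> eqFK (fmul (fmono [:: a]) Q) (fzero n).

Definition bounded p := exists D : nat, forall w, (D < size w)%N -> p w = 0.

Lemma is_dualP p : perp p -> bounded p -> is_dual p.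
Proof. by move=> pp bp; split=> // f; apply: perp_ideal. Qed.

Lemma homog_size p q d f : homog d f -> (forall w, size w = d -> p w = q w) ->
  pev p f = pev q f.
Proof.
move=> /allP hf e; rewrite /pev big_seq [RHS]big_seq; apply: eq_bigr => t /hf /eqP h.
by rewrite e.
Qed.

(* The functionals p * Q form a left ideal of E_G, since
   x (p * Q) = - p' * Q with p' = p(s_x(x _)) as soon as x Q = 0; evaluating in top
   degree shows that this left ideal contains 1. *)
Lemma ltop_generates G d Q0 : homog d Q0 -> ~ eqFK Q0 (fzero n) -> ltop G Q0 ->
  forall Q, Gpoly G Q -> exists p, [/\ perp p, bounded p & eqFK Q (dact p Q0)].
Proof.
move=> h0 n0 t0.
have zp : perp (fun _ : fkword n => 0) by move=> r _ u v; apply: pev_eq0.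
have word w : Gword G w ->
    exists p, [/\ perp p, bounded p & eqFK (fmono w) (dact p Q0)].
  elim: w => [|a w IH] /=.
    (* A homogeneous functional with value 1 on [Q0] must have degree [d]; then only [Q0] tensor 1
       contributes, and p * Q0 = 1. *)
    move=> _; have [e [p [pp pe p1]]] := neqFK0 n0.
    exists p; split=> //.
      exists e => w hw; apply: pe.
      by apply: contraTneq hw => ->; rewrite ltnn.
    have ed : e = d.
      case: (eqVneq e d) => // ne; move/eqP: p1; rewrite (@homog_size p (fun _ => 0) d) //.
        by rewrite pev_eq0 // eq_sym oner_eq0.
      by move=> w ew; apply: pe; rewrite ew eq_sym.
    apply/eqFKP => q pq; rewrite pev_mono pev_dact.
    rewrite (@homog_size _ (fun w => 0 + q [::] * p w) d) // => [|w ew].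
      by rewrite (pev_lin (fun _ => 0)) p1 pev_eq0 // add0r mulr1.
    rewrite cobil_topl ?add0r 1?mulrC // => v hv; apply: pe.
    by rewrite ed -ew neq_ltn hv.
  move=> /andP[Ga Gw]; have [p [pp [D pD] e]] := IH Gw.
  pose p' v := 0 + (-1) * p (map (tact a) (a :: v)).
  exists p'; split.
  - apply: perp_lin => //.
    exact: (perp_cons a (perp_act (tperm (sval a).1 (sval a).2) pp)).
  - exists D => v hv; rewrite /p' pD ?mulr0 ?addr0 //= size_map.
    by apply: leq_trans hv _; apply: leqnSn.
  - apply/eqFKP => q pq; rewrite pev_mono pev_dact.
    have := (eqFKP _ _).1 e _ (perp_cons a pq).
    rewrite pev_mono pev_dact => ->.
    (* The coproduct of [a] times [Q0] is tested against this functional tensor [q]. In the term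
       where [a] goes right, the transposition acts twice and leaves [p]; the other term is the one
       defining [p'], up to sign. *)
    have pa : perp (fun v => p (map (tact a) v)) := perp_act (tperm (sval a).1 (sval a).2) pp.
    have := (eqFK0P _).1 (t0 a Ga) _ (perp_cobil pa pq).
    rewrite pev_monol.
    under eq_pev => v.
      rewrite cat1s cobil_cons (@eq_cobil _ (fun v => p _) p (fun v => q (a :: v)) (fun v => q (a :: v))) //.
        rewrite -[X in X + _]mul1r addrC; over.
      by move=> v'; rewrite -map_comp map_id_in // => b _; apply: tactK.
    rewrite pev_lin mul1r => /eqP; rewrite addr_eq0 => /eqP ->.
    rewrite -mulN1r -[LHS]add0r -(@pev_eq0 _ (fun _ => 0) Q0) // -pev_lin.
    apply: eq_pev => v; rewrite /p' add0r mulN1r -cobilNl.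
    by apply: eq_cobil => // w'; rewrite add0r mulN1r.
(* From words to all of [Q] by linearity of p * Q0 in p. *)
elim=> [|[c w] Q IH] /=.
  move=> _; exists (fun _ => 0); split=> //; first by exists 0%N.
  apply/eqFKP => q pq; rewrite pev_dact pev_zero pev_eq0 // => t _.
  exact: cobil0l.
move=> /andP[Gw /IH[p [pp [D pD] e]]]; have [p' [pp' [D' pD'] e']] := word w Gw.
exists (fun v => p v + c * p' v); split; first exact: perp_lin.
  exists (maxn D D') => v; rewrite gtn_max => /andP[h h'].
  by rewrite pD // pD' // mulr0 addr0.
apply/eqFKP => q pq; have := (eqFKP _ _).1 e q pq; have := (eqFKP _ _).1 e' q pq.
rewrite !pev_dact pev_mono => hw hQ.
rewrite (_ : pev q _ = c * q w + pev q Q); last by rewrite /pev big_cons.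
rewrite hQ hw addrC -pev_lin; apply: eq_pev => v.
rewrite /cobil mulr_sumr -big_split; apply: eq_bigr => t _ /=; ring.
Qed.

End Coideal.

(** * The top degree *)

Section TopDegree.
Variables (n : nat) (G : rel 'I_n).
Implicit Types (p q : fkword n -> rat) (f g Q : fpoly n) (u v w : fkword n).
Implicit Types a b : fkgen n.

Lemma inEGdP d f :
  inEGd G d f <-> exists g, [/\ Gpoly G g, homog d g & eqFK f g].
Proof.
split=> [[g [/allP h e]]|[g [hG hd e]]]; exists g.
  by split=> //; apply/allP => t /h /andP[].
by split=> //; apply/allP => t tg; rewrite (allP hG _ tg) (allP hd _ tg).
Qed.

Lemma eqFK_refl f : eqFK f f. Proof. exact/eqFKP. Qed.
Lemma eqFK_sym f g : eqFK f g -> eqFK g f.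
Proof. by move=> /eqFKP e; apply/eqFKP => p /e. Qed.
Lemma eqFK_trans g f h : eqFK f g -> eqFK g h -> eqFK f h.
Proof. by move=> /eqFKP e /eqFKP e'; apply/eqFKP => p pp; rewrite e ?e'. Qed.

(** The degree [d.+1] part of [a] times [Q] is [a] times the degree [d] part of [Q]. *)
Lemma ltop_component d Q : ltop G Q -> ltop G (component d Q).
Proof.
move=> tQ a Ga; apply/eqFK0P => q pq; rewrite pev_monol pev_component.
have := (eqFK0P _).1 (tQ a Ga) _ (perp_at_size d.+1 pq).
by rewrite pev_monol => <-; apply: eq_pev => v.
Qed.

Lemma homog_component d Q : homog d (component d Q).
Proof. exact: filter_all. Qed.

Lemma Gpoly_component d Q : Gpoly G Q -> Gpoly G (component d Q).
Proof. by move=> /allP h; apply/allP => t; rewrite mem_filter => /andP[_ /h]. Qed.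

Definition top_degree d0 :=
  (exists f, inEGd G d0 f /\ ~ eqFK f (fzero n)) /\
  (forall d, (d0 < d)%N -> forall f, inEGd G d f -> eqFK f (fzero n)).

Variable d0 : nat.
Hypothesis topd : top_degree d0.

Lemma homog_above d Q : (d0 < d)%N -> Gpoly G Q -> homog d Q -> eqFK Q (fzero n).
Proof.
by move=> lt hG hd; apply: (topd.2 _ lt); apply/inEGdP; exists Q; split=> //; apply: eqFK_refl.
Qed.

Lemma word_above w : Gword G w -> (d0 < size w)%N -> eqFK (fmono w) (fzero n).
Proof. by move=> hw lt; apply: (homog_above lt); rewrite /Gpoly /homog /= ?hw ?eqxx. Qed.

(** Every p * Q lives in degrees at most [d], yet these elements exhaust E_G, which is nonzero in
    degree [d0]. *)
Lemma ltop_degree d Q : homog d Q -> ~ eqFK Q (fzero n) -> ltop G Q -> (d0 <= d)%N.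
Proof.
move=> hQ nQ tQ; rewrite leqNgt; apply/negP => lt.
have [[f [/inEGdP[g [hG hd e]] nf]] _] := topd.
apply: nf; apply: (eqFK_trans e).
have [p [pp _ /eqFKP eg]] := ltop_generates hQ nQ tQ hG.
apply/eqFK0P => q pq; have := eg _ (perp_at_size d0 pq).
rewrite (@homog_size _ _ q _ _ hd) => [->|w ew]; last by rewrite /at_size ew eqxx.
rewrite pev_dact (@homog_size _ _ (fun _ => 0) _ _ hQ) => [|w ew]; first by rewrite pev_eq0.
apply: cobil_lowr => v hv; rewrite /at_size; case: eqP => // ev.
by rewrite ev ew leqNgt lt in hv.
Qed.

(** Each component of [Q] is again in the left socle, so it vanishes below [d0] by [ltop_degree] and
    above [d0] by maximality. *)
Lemma ltop_eq_component Q : Gpoly G Q -> ltop G Q -> eqFK Q (component d0 Q).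
Proof.
move=> hG tQ; apply: NNPP => /perp_separation[e [p [pp pe]]].
have Qe : pev p Q = pev p (component e Q).
  rewrite pev_component; apply: eq_pev => w; rewrite /at_size; case: ifP => // /negbT.
  exact: pe.
rewrite pev_sub; case: (eqVneq e d0) => [ed|ne]; first by rewrite Qe ed subrr eqxx.
rewrite (@homog_size _ p (fun _ => 0) d0 _ (homog_component _ _)) => [|w ew]; last first.
  by apply: pe; rewrite ew eq_sym.
rewrite [X in _ - X]pev_eq0 // subr0 Qe => nz.
have nQ : ~ eqFK (component e Q) (fzero n).
  by move=> /eqFK0P h; rewrite h ?eqxx in nz.
have := ltop_degree (homog_component e Q) nQ (ltop_component e tQ).
rewrite leq_eqVlt eq_sym (negbTE ne) /= => lt; apply: nQ.
exact: (homog_above lt (Gpoly_component e hG) (homog_component e Q)).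
Qed.

Lemma top_word : exists w, [/\ Gword G w, size w = d0 & ~ eqFK (fmono w) (fzero n)].
Proof.
have [[f [/inEGdP[g [/allP hG /allP hd e]] nf]] _] := topd.
apply: NNPP => h; apply: nf; apply: (eqFK_trans e); apply/eqFK0P => p pp.
apply: pev_eq0 => t tg; rewrite -pev_mono; move: p pp; apply/eqFK0P.
apply: NNPP => nt; apply: h; exists t.2; split=> //; first exact: hG.
exact/eqP/hd.
Qed.

Variable w0 : fkword n.
Hypotheses (w0G : Gword G w0) (w0d : size w0 = d0) (w0n : ~ eqFK (fmono w0) (fzero n)).

Lemma ltop_w0 : ltop G (fmono w0).
Proof.
move=> a Ga; have h := @word_above (a :: w0); apply: h => /=; first by rewrite Ga.
by rewrite w0d.
Qed.

Lemma homog_w0 : homog d0 (fmono w0).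
Proof. by rewrite /homog /= w0d eqxx. Qed.

(** Write g = p * w0: in degree [d0] only the term 1 tensor [w0] contributes, so the scalar is the
    value of p at the empty word. *)
Lemma top_line g : Gpoly G g -> homog d0 g -> exists c, eqFK g (fscale c (fmono w0)).
Proof.
move=> hG hd; have [p [pp _ /eqFKP e]] := ltop_generates homog_w0 w0n ltop_w0 hG.
exists (p [::]); apply/eqFKP => q pq; rewrite pev_scale pev_mono.
have := e _ (perp_at_size d0 pq).
rewrite (@homog_size _ _ q _ _ hd) => [->|w ew]; last by rewrite /at_size ew eqxx.
rewrite pev_dact pev_mono cobil_topr => [|v hv]; first by rewrite /at_size w0d eqxx.
by rewrite /at_size -w0d; case: eqP hv => // ->; rewrite ltnn.
Qed.

Lemma Gpoly_monol u Q : Gword G u -> Gpoly G Q -> Gpoly G (fmul (fmono u) Q).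
Proof.
move=> hu /allP hQ; apply/allP => t /allpairsP[[s s'] [/=]].
by rewrite inE => /eqP -> /hQ hs ->; rewrite /Gword all_cat; apply/andP.
Qed.

Lemma homog_monol u d Q : homog d Q -> homog (size u + d) (fmul (fmono u) Q).
Proof.
move=> /allP hQ; apply/allP => t /allpairsP[[s s'] [/=]].
by rewrite inE => /eqP -> /hQ /eqP hs ->; rewrite size_cat hs.
Qed.

(** As long as some generator does not kill the product, it is put in front. Here [m] counts the
    letters missing to length [d0.+1], where the word itself is zero. *)
Lemma mono_ltop Q : ~ eqFK Q (fzero n) ->
  exists u, [/\ Gword G u, ~ eqFK (fmul (fmono u) Q) (fzero n) & ltop G (fmul (fmono u) Q)].
Proof.
move=> nQ.
suff H m u : Gword G u -> (size u + m = d0.+1)%N -> ~ eqFK (fmul (fmono u) Q) (fzero n) ->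
    exists u, [/\ Gword G u, ~ eqFK (fmul (fmono u) Q) (fzero n) & ltop G (fmul (fmono u) Q)].
  apply: (H d0.+1 [::]) => // /eqFK0P h; apply: nQ; apply/eqFK0P => p pp.
  by have := h p pp; rewrite pev_monol.
elim: m u => [|m IH] u hu su nu.
  case: nu; apply/eqFK0P => p pp; rewrite pev_monol.
  have /eqFK0P h : eqFK (fmono u) (fzero n) by apply: word_above; rewrite // -su addn0.
  rewrite pev_eq0 // => t _.
  by have := h _ (perp_ctx [::] t.2 pp); rewrite pev_mono.
case: (classic (ltop G (fmul (fmono u) Q))) => [|/not_all_ex_not[a nt]]; first by exists u.
have [Ga na] := imply_to_and _ _ nt.
apply: (IH (a :: u)); rewrite /= ?Ga ?addSnnS // => /eqFK0P h.
by apply: na; apply/eqFK0P => p pp; have := h p pp; rewrite !pev_monol.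
Qed.

Lemma mono_to_top Q : Gpoly G Q -> ~ eqFK Q (fzero n) ->
  exists u, Gword G u /\
    exists c, c != 0 /\ eqFK (fmul (fmono u) Q) (fscale c (fmono w0)).
Proof.
move=> hG nQ; have [u [hu nu tu]] := mono_ltop nQ.
exists u; split=> //; have hGu := Gpoly_monol hu hG.
have e := ltop_eq_component hGu tu.
have [c ec] := top_line (Gpoly_component d0 hGu) (homog_component d0 _).
exists c; split; last exact: (eqFK_trans e ec).
apply/eqP => c0; apply: nu; apply: (eqFK_trans e); apply: (eqFK_trans ec).
by apply/eqFK0P => p _; rewrite pev_scale c0 mul0r.
Qed.

(** The braiding acts on left factors only, so right factors keep their original letters in
    order. *)
Lemma subseq_cop_word w t : t \in cop_word w -> subseq t.2 w.
Proof.
elim: w t => [|a w IH] t; first by rewrite inE => /eqP ->.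
case/allpairsP=> -[s s'] [/=]; rewrite !inE => /orP[] /eqP -> /IH h -> /=.
  exact: subseq_trans h (subseq_cons _ _).
by rewrite eqxx.
Qed.

(** The given expression [u] takes the place of [Q0] in [ltop_generates]; the words of
    [dact p (fmono u)] are right factors of the coproduct of [u]. *)
Lemma subwords_span u Q : Gword G u -> size u = d0 -> eqFK (fmono u) (fmono w0) ->
  Gpoly G Q -> exists f, all (fun t => subseq t.2 u) f /\ eqFK Q f.
Proof.
move=> hu su eu hQ.
have nu : ~ eqFK (fmono u) (fzero n).
  by move=> h; apply: w0n; apply: eqFK_trans (eqFK_sym eu) h.
have hom : homog d0 (fmono u) by rewrite /homog /= su eqxx.
have tu : ltop G (fmono u).
  by move=> a Ga; apply: (@word_above (a :: u)); rewrite /= ?Ga ?su.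
have [p [_ _ e]] := ltop_generates hom nu tu hQ.
exists (dact p (fmono u)); split=> //; apply/allP => t /mapP[s + ->] /=.
by rewrite /cop /= cats0 => /mapP[s' /subseq_cop_word h ->].
Qed.

Lemma rev_top : eqFK (fmono (rev w0)) (fmono w0) \/
  eqFK (fmono (rev w0)) (fscale (-1) (fmono w0)).
Proof.
have rG : Gpoly G (fmono (rev w0)) by rewrite /Gpoly /= /Gword all_rev andbT.
have rd : homog d0 (fmono (rev w0)) by rewrite /homog /= size_rev w0d eqxx.
have [c e] := top_line rG rd.
have ec p : perp p -> p (rev w0) = c * p w0.
  by move=> pp; have := perp_eqFK pp e; rewrite pev_scale !pev_mono.
have [d [p [pp _ p1]]] := neqFK0 w0n.
(* Applying rev w0 = c w0 to both [p] and its composite with reversal gives 1 = c^2. *)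
rewrite pev_mono in p1; have := ec _ (perp_rev pp); rewrite revK (ec _ pp) p1 mulr1.
move/esym/eqP; rewrite -expr2 sqrf_eq1 => /orP[] /eqP c1; [left|right];
  apply: (eqFK_trans e); rewrite c1; apply/eqFKP => q _; by rewrite !pev_scale ?mul1r.
Qed.

End TopDegree.

(** * Dimensions *)

Section Dimension.
Variable n : nat.
Implicit Types (p q : fkword n -> rat) (f g Q : fpoly n) (u v w : fkword n).

Definition comb N (ws : 'I_N -> fpoly n) (c : 'rV[rat]_N) : fpoly n :=
  lincomb [seq c 0 i | i <- enum 'I_N] [seq ws i | i <- enum 'I_N].

Lemma pev_comb p N (ws : 'I_N -> fpoly n) c :
  pev p (comb ws c) = \sum_i c 0 i * pev p (ws i).
Proof.
rewrite /comb /lincomb zip_map -map_comp -big_enum.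
elim: (enum 'I_N) => [|i s IH]; first by rewrite big_nil /pev big_nil.
by rewrite big_cons -IH -[X in _ = X + _]pev_scale -pev_add.
Qed.

(** The linear relations among the [ws] are the left kernel of [A], so their span is isomorphic to
    the row space of [A]; the [ws] at a maximal free set of rows form a basis. *)
Lemma dimFK_rank N m (ws : 'I_N -> fpoly n) (A : 'M[rat]_(N, m)) (S : fpoly n -> Prop) :
  (forall i, S (ws i)) ->
  (forall f, S f -> exists c, eqFK f (comb ws c)) ->
  (forall c, eqFK (comb ws c) (fzero n) <-> c *m A = 0) ->
  dimFK S (\rank A).
Proof.
move=> wsS span ker; pose h := maxrankfun A.
have comb_sel (c : 'rV_(\rank A)) :
    forall p, pev p (comb (ws \o h) c) = pev p (comb ws (c *m rowsub h 1%:M)).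
  move=> p; rewrite !pev_comb.
  under [RHS]eq_bigr do rewrite mxE mulr_suml.
  rewrite exchange_big; apply: eq_bigr => i _ /=.
  rewrite (bigD1 (h i)) //= !mxE eqxx mulr1 big1 ?addr0 // => j /negbTE nj.
  by rewrite !mxE eq_sym nj mulr0 mul0r.
have selA (c : 'rV_(\rank A)) : c *m rowsub h 1%:M *m A = c *m rowsub h A.
  by rewrite -mulmxA mul_rowsub_mx mul1mx.
exists [seq (ws \o h) i | i <- enum 'I_(\rank A)]; split.
- by rewrite size_map size_enum_ord.
- by move=> b /mapP[i _ ->]; apply: wsS.
- move=> f /span[c ec].
  have : (c *m A <= rowsub h A)%MS by rewrite eq_maxrowsub submxMl.
  case/submxP=> c' ec'.
  exists [seq c' 0 i | i <- enum 'I_(\rank A)].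
  apply: (eqFK_trans ec); apply/eqFKP => p pp; rewrite -/(comb (ws \o h) c') comb_sel.
  apply/subr0_eq.
  have /ker/eqFK0P/(_ p pp) : (c - c' *m rowsub h 1%:M) *m A = 0.
    by rewrite mulmxBl selA ec' subrr.
  rewrite !pev_comb -sumrB => h0; rewrite -[RHS]h0; apply: eq_bigr => i _.
  by rewrite -mulrBl [in RHS]mxE [X in _ = (_ + X) * _]mxE.
- move=> cs scs e0; pose c := \row_(i < \rank A) cs`_i.
  have ecs : cs = [seq c 0 i | i <- enum 'I_(\rank A)].
    apply: (@eq_from_nth _ 0); first by rewrite size_map size_enum_ord.
    move=> i; rewrite scs => hi; rewrite (nth_map (Ordinal hi)) ?size_enum_ord //.
    by rewrite mxE nth_enum_ord.
  have c0 : c = 0.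
    apply: (row_free_inj (maxrowsub_free A)).
    rewrite mul0mx -/h -selA; apply/ker/eqFK0P => p pp.
    by rewrite -comb_sel /comb -ecs; move/eqFK0P: e0; apply.
  by move=> x; rewrite ecs c0 => /mapP[i _ ->]; rewrite mxE.
Qed.

Variable G : rel 'I_n.

(** Words outside [G] are replaced by zero so that all tuples of a given length can serve as
    indices. *)
Definition Gmono w : fpoly n := if Gword G w then fmono w else fzero n.

Lemma pev_Gmono p w : pev p (Gmono w) = if Gword G w then p w else 0.
Proof. by rewrite /Gmono; case: ifP; rewrite ?pev_mono ?pev_zero. Qed.

Definition tupleword d (i : 'I_#|{: d.-tuple (fkgen n)}|) : fkword n :=
  (enum_val i : d.-tuple (fkgen n)).

Lemma Gcomb_inEGd d c : inEGd G d (comb (fun i => Gmono (@tupleword d i)) c).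
Proof.
pose g : fpoly n := [seq (c 0 i, @tupleword d i) | i <- enum 'I_#|{: d.-tuple (fkgen n)}|].
exists [seq t <- g | Gword G t.2]; split.
  apply/allP => t; rewrite mem_filter => /andP[-> /mapP[i _ ->]] /=.
  by rewrite size_tuple eqxx.
apply/eqFKP => p _; rewrite pev_comb [RHS]big_filter [RHS]big_mkcond big_map big_enum.
by apply: eq_bigr => i _; rewrite pev_Gmono; case: ifP; rewrite ?mulr0.
Qed.

Lemma Gcomb_span d f : inEGd G d f ->
  exists c, eqFK f (comb (fun i => Gmono (@tupleword d i)) c).
Proof.
case/inEGdP=> g [/allP hG hd e]; exists (wordrow d g); apply: (eqFK_trans e).
apply/eqFKP => p _; rewrite pev_comb.
have -> : pev p g = pev p (wordpoly (wordrow d g)).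
  rewrite -(pev_fcoef p (fcoef_component d g)); congr pev.
  exact/esym/all_filterP.
rewrite pev_wordpoly [RHS](reindex (@enum_rank {: d.-tuple (fkgen n)})) /=; last first.
  by apply: onW_bij; apply: enum_rank_bij.
apply: eq_bigr => t _; rewrite pev_Gmono /tupleword enum_rankK; case: ifP => // nt.
rewrite mxE enum_rankK mulr0 fcoefE pev_eq0 ?mul0r // => s /hG hs.
by case: eqP => // es; rewrite es nt in hs.
Qed.

(** * The pairing into the top degree *)

Variable d0 : nat.
Hypothesis topd : top_degree G d0.
Variable q0 : fkword n -> rat.
Variable w0 : fkword n.
Hypotheses (w0G : Gword G w0) (w0d : size w0 = d0) (q0p : perp q0) (q0w : q0 w0 = 1).

(* The matrix of the pairing (P, Q) |-> PQ of the degree d0 - d and degree d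
   parts, where E_G^{d0} is identified with Q through q0. *)
Definition pairing d e :=
  \matrix_(i < #|{: d.-tuple (fkgen n)}|, j < #|{: e.-tuple (fkgen n)}|)
    if Gword G (tupleword i) && Gword G (tupleword j)
    then q0 (tupleword j ++ tupleword i) else 0.

Lemma mul_pairing d e c j :
  (c *m pairing d e) 0 j = if Gword G (tupleword j)
    then pev (fun w => q0 (tupleword j ++ w)) (comb (fun i => Gmono (tupleword i)) c) else 0.
Proof.
rewrite mxE pev_comb; case: ifP => hj; last first.
  by rewrite big1 // => i _; rewrite mxE hj andbF mulr0.
by apply: eq_bigr => i _; rewrite mxE hj andbT pev_Gmono.
Qed.

Lemma mul_pairing_tr d e c j :
  (c *m (pairing d e)^T) 0 j = if Gword G (tupleword j)
    then pev (fun w => q0 (w ++ tupleword j)) (comb (fun i => Gmono (tupleword i)) c) else 0.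
Proof.
rewrite mxE pev_comb; case: ifP => hj; last first.
  by rewrite big1 // => i _; rewrite !mxE hj mulr0.
by apply: eq_bigr => i _; rewrite !mxE hj pev_Gmono.
Qed.

(** Nondegeneracy: a nonzero element is carried to a nonzero multiple of [w0] by some word [u] on
    the left, and the column of [u] detects it. *)
Lemma pairing_ker d e c : (d + e)%N = d0 ->
  eqFK (comb (fun i => Gmono (@tupleword d i)) c) (fzero n) <-> c *m pairing d e = 0.
Proof.
move=> de; split=> [/eqFK0P h|c0].
  apply/rowP => j; rewrite mul_pairing [RHS]mxE; case: ifP => // _.
  apply: h; have := perp_ctx (tupleword j) [::] q0p.
  by apply: perp_ext => w; rewrite cats0.
apply: NNPP; set f := comb _ _ => nf.
have [g [gG gd eg]] := (inEGdP _ _ _).1 (Gcomb_inEGd c).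
have ng : ~ eqFK g (fzero n) by move=> h; apply: nf; apply: eqFK_trans eg h.
have w0n : ~ eqFK (fmono w0) (fzero n).
  by move/eqFK0P/(_ _ q0p); rewrite pev_mono q0w => /eqP; rewrite oner_eq0.
have [u [uG [k [k0 /eqFKP ek]]]] := mono_to_top topd w0G w0d w0n gG ng.
(* Otherwise the product has degree other than [d0], and the part of [q0] in degree [d0], which has
   value [k] on it, would vanish. *)
have su : size u = e.
  apply/eqP; rewrite -(eqn_add2r d) (addnC e) de; apply/negPn/negP => ne.
  have := ek _ (perp_at_size d0 q0p); rewrite pev_scale pev_mono {2}/at_size w0d eqxx q0w mulr1.
  rewrite (@homog_size _ _ (fun _ => 0) _ _ (homog_monol u gd)) => [|w ew].
    by rewrite pev_eq0 // => /esym/eqP; rewrite (negbTE k0).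
  by rewrite /at_size ew (negbTE ne).
pose t : e.-tuple (fkgen n) := Tuple (introT eqP su).
have ut : tupleword (enum_rank t) = u by rewrite /tupleword enum_rankK.
have := mul_pairing c (enum_rank t); rewrite c0 mxE ut uG.
have pu : perp (fun w => q0 (u ++ w)).
  by have := perp_ctx u [::] q0p; apply: perp_ext => w; rewrite cats0.
rewrite (perp_eqFK pu eg) -pev_monol ek // pev_scale pev_mono q0w mulr1 => /esym/eqP.
by rewrite (negbTE k0).
Qed.

Lemma dimFK_pairing d e : (d + e)%N = d0 -> dimFK (inEGd G d) (\rank (pairing d e)).
Proof.
move=> de; apply: (@dimFK_rank _ _ (fun i => Gmono (@tupleword d i))).
- move=> i; rewrite /Gmono; case: ifP => h; last by exists [::]; split=> //; apply: eqFK_refl.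
  exists (fmono (tupleword i)); split; last exact: eqFK_refl.
  by rewrite /= h size_tuple eqxx.
- exact: Gcomb_span.
- by move=> c; apply: pairing_ker.
Qed.

(** A row vector killed by [pairing e d] represents zero in E_G, so it also pairs to zero with
    factors on the other side, that is, through the transpose of [pairing d e]. Comparing kernels
    compares ranks. *)
Lemma rank_pairing_le d e : (d + e)%N = d0 ->
  (\rank (pairing d e) <= \rank (pairing e d))%N.
Proof.
move=> de; have ed : (e + d)%N = d0 by rewrite addnC.
have : (kermx (pairing e d) <= kermx (pairing d e)^T)%MS.
  apply/sub_kermxP/row_matrixP => i; rewrite row_mul row0.
  have /(pairing_ker _ ed)/eqFK0P h : row i (kermx (pairing e d)) *m pairing e d = 0.
    by rewrite -row_mul mulmx_ker row0.
  apply/rowP => j; rewrite mul_pairing_tr [RHS]mxE; case: ifP => // _.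
  exact: h (perp_ctx [::] (tupleword j) q0p).
move/mxrankS; rewrite !mxrank_ker mxrank_tr => h.
by rewrite -(subKn (rank_leq_row (pairing e d))) leq_subRL ?leq_subr //
  addnC -leq_subRL ?(leq_trans h) //; rewrite -mxrank_tr rank_leq_row.
Qed.

Lemma dimFK_palindromic d : (d <= d0)%N ->
  exists k, dimFK (inEGd G d) k /\ dimFK (inEGd G (d0 - d)) k.
Proof.
move=> hd; exists (\rank (pairing d (d0 - d))); split; first by apply: dimFK_pairing; rewrite subnKC.
have -> : \rank (pairing d (d0 - d)) = \rank (pairing (d0 - d) d).
  by apply/eqP; rewrite eqn_leq !rank_pairing_le ?subnKC ?subnK.
by apply: dimFK_pairing; rewrite subnK.
Qed.

End Dimension.

(** * Assembly of (a) to (f) from the results on the top degree *)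

Theorem mainTheorem1 (n : nat) (G : rel 'I_n)
  (hn : (0 < n)%N) (Gsym : symmetric G) (Girr : irreflexive G)
  (hfin : findimEG G)
  (d0 : nat)
  (hd0 : exists f, inEGd G d0 f /\ ~ eqFK f (fzero n))
  (hmax : forall d, (d0 < d)%N -> forall f, inEGd G d f -> eqFK f (fzero n)) :
  (* (a) *)
  (exists w0 : fkword n, [/\ Gword G w0, size w0 = d0, ~ eqFK (fmono w0) (fzero n) &
      forall f, inEGd G d0 f -> exists c : rat, eqFK f (fscale c (fmono w0))])
  /\
  (* (d) *)
  (forall d, (d <= d0)%N ->
     exists k, dimFK (inEGd G d) k /\ dimFK (inEGd G (d0 - d)) k)
  /\
  (* (b), (c), (e), (f) for the (any) spanning monomial w0 of E_G^{d0} *)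
  (forall w0 : fkword n, Gword G w0 -> size w0 = d0 -> ~ eqFK (fmono w0) (fzero n) ->
     [/\ (* (b) *)
         forall Q, inEG G Q ->
           exists p : fkword n -> rat, is_dual p /\ eqFK Q (dact p (fmono w0)),
         (* (c) *)
         forall Q, inEG G Q -> ~ eqFK Q (fzero n) ->
           exists P : fkword n, Gword G P /\
             exists c : rat, c != 0 /\ eqFK (fmul (fmono P) Q) (fscale c (fmono w0)),
         (* (e) *)
         forall p : fkword n, Gword G p -> size p = d0 -> eqFK (fmono p) (fmono w0) ->
           forall Q, inEG G Q ->
             exists f : fpoly n, all (fun t => subseq t.2 p) f /\ eqFK Q f &
         (* (f) *)
         eqFK (fmono (rev w0)) (fmono w0) \/
         eqFK (fmono (rev w0)) (fscale (-1) (fmono w0))]).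
Proof.
have topd : top_degree G d0 by [].
split; [|split].
- have [w0 [w0G w0d w0n]] := top_word topd.
  exists w0; split=> // f /inEGdP[g [gG gd e]].
  by have [c ec] := top_line topd w0G w0d w0n gG gd; exists c; apply: eqFK_trans e ec.
- have [w0 [w0G w0d w0n]] := top_word topd.
  (* The functional [q], with value 1 on [w0], identifies the top degree with the rationals. *)
  have [_ [q [qp _]]] := neqFK0 w0n; rewrite pev_mono.
  exact: dimFK_palindromic topd _ _ w0G w0d qp.
move=> w0 w0G w0d w0n; split.
- move=> Q [g [gG e]].
  have [p [pp pb ep]] := ltop_generates (homog_w0 w0d) w0n (ltop_w0 topd w0G w0d) gG.
  by exists p; split; [apply: is_dualP | apply: eqFK_trans e ep].
- move=> Q [g [gG e]] nQ.
  have ng : ~ eqFK g (fzero n) by move=> h; apply: nQ; apply: eqFK_trans e h.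
  have [u [uG [c [c0 ec]]]] := mono_to_top topd w0G w0d w0n gG ng.
  exists u; split=> //; exists c; split=> //; apply: eqFK_trans ec.
  (* Left multiplication by [u] respects equality in E_n, since composing a functional with it stays
     in [perp]. *)
  apply/eqFKP => q qp; rewrite !pev_monol; apply: perp_eqFK e.
  by have := perp_ctx u [::] qp; apply: perp_ext => w; rewrite cats0.
- move=> p pG pd ep Q [g [gG e]].
  have [f [hf ef]] := subwords_span topd w0n pG pd ep gG.
  by exists f; split=> //; apply: eqFK_trans e ef.
- exact: (rev_top topd w0G w0d w0n).
Qed.
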